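(* Let $T$ be a finite non-abelian simple group, $k\ge 2$, and let $G=T^k.S_k\le D(k,T)$ be a primitive simple diagonal group. Then $$\mathrm{orbdiam}(G)\le 24(k-1)\,c_i(T)^2.$$
   Context: Simple diagonal groups. $T$ is identified with $\mathrm{Inn}(T)\le \mathrm{Aut}(T)$. Define $D(k,T)=\{(\tau_1,\dots,\tau_k).\pi : \tau_i\in \mathrm{Aut}(T),\ \pi\in S_k,\ \text{all } \tau_i \text{ lie in the same } \mathrm{Inn}(T)\text{-coset}\}\le \mathrm{Aut}(T)\,\mathrm{wr}\,S_k$; it contains $T^k$ as a normal subgroup with $D(k,T)/T^k\cong \mathrm{Out}(T)\times S_k$. $G=T^k.S_k$ denotes the preimage in $D(k,T)$ of the subgroup $1\times S_k$. Let $W=\{(\alpha,\dots,\alpha).\pi : \alpha\in \mathrm{Aut}(T),\pi\in S_k\}$ and $D_A=W\cap G$. $G$ acts by right multiplication on the set $\Omega=(G:D_A)$ of right cosets of $D_A$ in $G$, and it is a primitive simple diagonal group if this action is primitive. Orbital diameter. For a primitive permutation group $G$ on a finite set $\Omega$, an orbital is an orbit of $G$ on $\Omega\times\Omega$; for each non-diagonal orbital $\Gamma$ the corresponding orbital graph is the undirected graph with vertex set $\Omega$ and edges $\{\alpha,\beta\}$ for $(\alpha,\beta)\in\Gamma$. $\mathrm{orbdiam}(G)$ is the supremum of the diameters of the orbital graphs of $G$. Widths. For a generating set $S$ of $T$, $w_S(T)$ is the minimal $m\in\mathbb N$ such that every element of $T$ is a product of at most $m$ elements of $S$. $c_i(T)=\max_{t\in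 T\setminus\{1\}} w_{C}(T)$ with $C=t^T\cup(t^{-1})^T$. *)

(* Defs.v *)
From HB Require Import structures.
From mathcomp Require Import all_boot all_order all_algebra.
From mathcomp Require Import all_fingroup all_solvable.
From mathcomp Require Export constructive_ereal.

Set Implicit Arguments.
Unset Strict Implicit.
Unset Printing Implicit Defensive.

Import Order.TTheory GRing.Theory Num.Theory.

Local Open Scope group_scope.

(* Graph distance and diameter take values in [\bar int], so that a
   disconnected graph has diameter +oo. *)
Section Graphs.

Variables (V : finType) (e : rel V).

Definition walk (n : nat) (x y : V) : bool :=
  [exists p : n.-tuple V, path e x p && (last x p == y)].

(* A shortest walk has no repeated vertex, so lengths below #|V| suffice; see
   [gdist_leP]. *)
Definition gdist (x y : V) : \bar int :=
  \big[Order.min/+oo%E]_(n < #|V| | walk n x y) (n%:Z)%:E.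

Definition gdiam (A : {set V}) : \bar int :=
  \big[Order.max/0%E]_(x in A) \big[Order.max/0%E]_(y in A) gdist x y.

Lemma gdist_leP (x y : V) (n : nat) :
  reflect (exists2 p, path e x p /\ last x p = y & size p <= n)
          (gdist x y <= (n%:Z)%:E)%E.
Proof.
have [H|H] := boolP [exists m : 'I_#|V|, walk m x y && (m <= n)].
- have le : (gdist x y <= (n%:Z)%:E)%E.
    have [m /andP[w lemn]] := existsP H.
    apply: (@le_trans _ _ (m%:Z)%:E); first exact: bigmin_le_cond.
    by rewrite lee_fin lez_nat.
  rewrite le; constructor.
  have [m /andP[/existsP[p /andP[pp /eqP lp]] mn]] := existsP H.
  by exists p => //; rewrite size_tuple.
- have nle : (gdist x y <= (n%:Z)%:E)%E = false.
    apply/negbTE; rewrite -ltNge /gdist; elim/big_ind: _ => //=.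
    + by move=> a b ha hb; rewrite lt_min ha hb.
    + move=> m w; rewrite lte_fin ltz_nat ltnNge; apply: contra H => mn.
      by apply/existsP; exists m; rewrite w.
  rewrite nle; constructor => -[p [pp lp] sp].
  have [q [pq lq uq leq_qp]] : exists q,
      [/\ path e x q, last x q = y, uniq (x :: q) & size q <= size p].
    move: lp; case/shortenP: pp => q pq uq sub lq.
    exists q; split=> //; apply: uniq_leq_size (sub).
    by move: uq; rewrite cons_uniq => /andP[].
  have sq : size q < #|V|.
    by have := max_card (mem (x :: q)); rewrite (card_uniqP uq).
  case/existsP: H; exists (Ordinal sq); rewrite (leq_trans leq_qp sp) andbT.
  by apply/existsP; exists (in_tuple q); rewrite pq lq eqxx.
Qed.

End Graphs.

Section Orbitals.

Variables (aT : finGroupType) (sT : finType) (to : {action aT &-> sT}).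

Definition pair_act (u : sT * sT) (a : aT) : sT * sT := (to u.1 a, to u.2 a).

Lemma pair_act1 : pair_act^~ 1 =1 id.
Proof. by case=> x y; rewrite /pair_act /= !act1. Qed.

Lemma pair_actM u : act_morph pair_act u.
Proof. by move=> a b; rewrite /pair_act /= !actM. Qed.

Canonical pair_action := TotalAction pair_act1 pair_actM.

Variables (A : {set aT}) (S : {set sT}).

Definition orbitals : {set {set sT * sT}} :=
  orbit pair_action A @: setX S S.

Definition diagonal : {set sT * sT} := [set (x, x) | x in S].

Definition orbital_graph (Gamma : {set sT * sT}) : rel sT :=
  [rel x y | ((x, y) \in Gamma) || ((y, x) \in Gamma)].

Definition orbdiam : \bar int :=
  \big[Order.max/0%E]_(Gamma in orbitals | Gamma != diagonal)
    gdiam (orbital_graph Gamma) S.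

End Orbitals.

Section Widths.

Variables (gT : finGroupType) (T : {group gT}).

(* The products of at most m elements of S; [S ^+ j] is a setwise power. *)
Definition prods_upto (S : {set gT}) (m : nat) : {set gT} :=
  \bigcup_(j < m.+1) S ^+ j.

(* Only meaningful when S generates T, in which case the minimum exists and is
   at most #|T|; see [widthP]. *)
Definition width (S : {set gT}) : nat :=
  [arg min_(m < (ord_max : 'I_#|T|.+1) | T \subset prods_upto S m) m].

Definition c_i : nat := \max_(t in T^#) width (t ^: T :|: t^-1 ^: T).

Lemma widthP (S : {set gT}) : <<S>> = T ->
  T \subset prods_upto S (width S) /\
  (forall m, T \subset prods_upto S m -> width S <= m).
Proof.
move=> genS.
have max_ok : T \subset prods_upto S (ord_max : 'I_#|T|.+1).
  pose e := [rel u v : gT | u^-1 * v \in S].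
  have pathS u p : path e u p -> u^-1 * last u p \in S ^+ size p.
    elim: p u => [|v p IHp] u /=; first by rewrite mulVg expg0 set11.
    case/andP=> euv /IHp Sp; rewrite expgS.
    by rewrite -(mulKVg v (last v p)) mulgA mem_mulg.
  apply/subsetP=> x; rewrite -{1}genS => /gen_prodgP[n [c Sc defx]].
  have [p pp lp] : exists2 p, path e 1 p & last 1 p = x.
    rewrite {}defx; elim: n c Sc => [|n IHn] c Sc.
      by exists [::]; rewrite ?big_ord0.
    have [//|p pp lp] := IHn (fun i => c (widen_ord (leqnSn n) i)).
    exists (rcons p (last 1 p * c ord_max)).
      by rewrite rcons_path pp /= mulKg Sc.
    by rewrite last_rcons big_ord_recr lp.
  have TS : S \subset T by rewrite -genS subset_gen.
  have pathT q : forall u, u \in T -> path e u q -> {subset q <= T}.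
    elim: q => // v q IHq u Tu /= /andP[euv pq].
    have Tv : v \in T by rewrite -(mulKVg u v) groupM // (subsetP TS).
    by move=> w; rewrite inE => /predU1P[->|/(IHq v Tv pq)].
  move: lp; case/shortenP: pp => q pq uq _ lq.
  have sq : size q <= #|T|.
    move: uq; rewrite cons_uniq => /andP[_ /card_uniqP <-].
    by apply/subset_leq_card/subsetP; apply: pathT pq.
  apply/bigcupP; exists (Ordinal (sq : size q < #|T|.+1)) => //.
  by have := pathS _ _ pq; rewrite invg1 mul1g lq.
rewrite /width; case: arg_minnP => // m Tm minm; split=> // j Tj.
have [ltj|] := ltnP j #|T|.+1; first exact: (minm (Ordinal ltj)).
by apply: leq_trans; rewrite -ltnS ltnS ltnW.
Qed.

End Widths.

(* The wreath product K wr S_k. The action is f^pi (i) = f (pi^-1 i), so that,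
   permutations being composed from left to right, i |-> f i is moved to
   position pi i. *)
Section Wreath.

Variables (K : finGroupType) (k : nat).

Notation base := {dffun forall _ : 'I_k, K}.

Definition wr_act (f : base) (pi : 'S_k) : base := [ffun i => f (pi^-1 i)].

Lemma wr_act1 : wr_act^~ 1 =1 id.
Proof. by move=> f; apply/ffunP=> i; rewrite ffunE invg1 perm1. Qed.

Lemma wr_actM f : act_morph wr_act f.
Proof. by move=> p q; apply/ffunP=> i; rewrite !ffunE invMg permM. Qed.

Definition wr_action := TotalAction wr_act1 wr_actM.

Lemma wr_is_groupAction : is_groupAction [set: base] wr_action.
Proof.
move=> p _; rewrite inE; apply/andP; split.
  by apply/subsetP=> f _; rewrite inE.
by apply/morphicP=> f g _ _; rewrite !permE; apply/ffunP=> i; rewrite !ffunE.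
Qed.

Definition wr_groupAction := GroupAction wr_is_groupAction.

Definition wreath := sdprod_by wr_groupAction.
HB.instance Definition _ := FinGroup.on wreath.

Definition wr (f : base) (pi : 'S_k) : wreath :=
  sdpair1 wr_groupAction f * sdpair2 wr_groupAction pi.

Lemma wrM f p g q :
  wr f p * wr g q = wr [ffun i => f i * g (p i)] (p * q).
Proof.
have -> : [ffun i => f i * g (p i)] = f * wr_act g p^-1.
  by apply/ffunP=> i; rewrite !ffunE invgK.
have actE : sdpair1 wr_groupAction (wr_act g p^-1) =
            sdpair1 wr_groupAction g ^ sdpair2 wr_groupAction p^-1.
  by apply: (sdpair_act wr_groupAction); rewrite inE.
rewrite /wr sdpair1_morphM ?inE // sdpair2_morphM ?inE // actE.
rewrite (morphV (sdpair2_morphism wr_groupAction)) ?inE //=.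
by rewrite /conjg invgK !mulgA mulgKV.
Qed.

End Wreath.

Section SimpleDiagonal.

Variables (gT : finGroupType) (T : {group gT}) (k : nat).

Notation base := {dffun forall _ : 'I_k, {perm gT}}.

Definition Inn : {group {perm gT}} := (conj_aut T @* T)%G.

(* [Aut T] is a subgroup of {perm gT}, so Aut(T) wr S_k is realised inside
   {perm gT} wr S_k. *)
Definition same_Inn_coset (f : base) : bool :=
  [forall i, f i \in Aut T] && [forall i, forall j, Inn :* f i == Inn :* f j].

Definition diagD : {set wreath {perm gT} k} :=
  [set wr f pi | f in same_Inn_coset, pi in [set: 'S_k]].

(* T^k.S_k, the preimage of 1 x S_k under diagD -> Out(T) x S_k, which sends
   [wr f pi] to (c, pi), where c is the
   common value of the [coset Inn (f i)]. *)
Definition diagG : {set wreath {perm gT} k} :=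
  [set wr f pi | f in [pred f : base | same_Inn_coset f &
                        [forall i, coset Inn (f i) == 1]],
                 pi in [set: 'S_k]].

Definition diagW : {set wreath {perm gT} k} :=
  [set wr [ffun=> alpha] pi | alpha in Aut T, pi in [set: 'S_k]].

Definition diagDA : {set wreath {perm gT} k} := diagW :&: diagG.

Definition diagOmega : {set {set wreath {perm gT} k}} := rcosets diagDA diagG.

Lemma Inn_sub_Aut : Inn \subset Aut T.
Proof. exact: Aut_conj_aut. Qed.

Lemma Inn_norm : Aut T \subset 'N(Inn).
Proof.
apply/subsetP=> a Aa; rewrite inE; apply/subsetP=> _ /imsetP[b Ib ->].
case/morphimP: Ib => t _ Tt ->.
have AVa : a^-1 \in Aut T by rewrite groupV.
have inA u : u \in T -> conj_aut T u \in Aut T.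
  by move=> Tu; rewrite (subsetP Inn_sub_Aut) ?mem_morphim ?(subsetP (normG T)).
have Tat : a t \in T by apply: Aut_closed.
suff -> : conj_aut T t ^ a = conj_aut T (a t).
  by rewrite mem_morphim ?(subsetP (normG T)).
apply: (@eq_Aut _ T); rewrite ?groupJ ?inA // => x Tx.
have Tx' : a^-1 x \in T by apply: Aut_closed.
rewrite conj_autE // /conjg !permM conj_autE //.
have -> : a (a^-1 x ^ t) = a (a^-1 x) ^ a t by apply: (morphJ (autm_morphism Aa)).
by rewrite permKV.
Qed.

Lemma same_Inn_cosetP (f : base) :
  reflect ((forall i, f i \in Aut T) /\
           (forall i j, coset Inn (f i) = coset Inn (f j)))
          (same_Inn_coset f).
Proof.
apply: (iffP andP) => [[/forallP fA /forallP fI]|[fA fI]].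
  split=> // i j; apply/rcoset_kercosetP; rewrite ?(subsetP Inn_norm) //.
  by move/forallP/(_ j)/eqP: (fI i) => <-; rewrite rcoset_refl.
split; apply/forallP=> // i; apply/forallP=> j; apply/eqP/rcoset_eqP.
by apply/rcoset_kercosetP; rewrite ?(subsetP Inn_norm).
Qed.

Lemma diagGP w :
  reflect (exists2 f : base, (forall i, f i \in Inn) & exists pi, w = wr f pi)
          (w \in diagG).
Proof.
apply: (iffP imset2P) => [[f pi /andP[/andP[/forallP fA _] /forallP f1] _ ->]|].
  exists f; last by exists pi.
  move=> i; apply: coset_idr; last exact/eqP.
  by rewrite (subsetP Inn_norm).
case=> f fI [pi ->]; exists f pi; rewrite ?inE // -?topredE /=.
apply/andP; split; last by apply/forallP=> i; rewrite coset_id.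
apply/same_Inn_cosetP; split=> [i|i j]; last by rewrite !coset_id.
by rewrite (subsetP Inn_sub_Aut).
Qed.

Lemma diagG_sub_D : diagG \subset diagD.
Proof.
apply/subsetP=> _ /imset2P[f pi /andP[fD _] _ ->].
by apply: imset2_f; rewrite ?inE.
Qed.

Lemma group_set_diagD : group_set diagD.
Proof.
apply/group_setP; split.
  apply/imset2P; exists 1 1; rewrite ?inE //.
    rewrite -?topredE /=; apply/same_Inn_cosetP.
    by split=> [i|i j]; rewrite !oneg_ffun ?group1.
  by rewrite /wr !morph1 mulg1.
move=> u v /imset2P[f p /same_Inn_cosetP[fA fI] _ ->].
case/imset2P=> g q /same_Inn_cosetP[gA gI] _ ->.
rewrite wrM; apply/imset2P; exists [ffun i => f i * g (p i)] (p * q);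
  rewrite ?inE // -?topredE /=.
apply/same_Inn_cosetP; split=> [i|i j]; rewrite !ffunE ?groupM //.
rewrite !morphM ?(subsetP Inn_norm) //=.
by congr (_ * _); [apply: fI | apply: gI].
Qed.
Canonical diagD_group := Group group_set_diagD.

Lemma group_set_diagG : group_set diagG.
Proof.
apply/group_setP; split.
  apply/diagGP; exists 1 => [i|]; first by rewrite oneg_ffun group1.
  by exists 1; rewrite /wr !morph1 mulg1.
move=> u v /diagGP[f fI [p ->]] /diagGP[g gI [q ->]]; rewrite wrM.
apply/diagGP; exists [ffun i => f i * g (p i)]; last by exists (p * q).
by move=> i; rewrite ffunE groupM.
Qed.
Canonical diagG_group := Group group_set_diagG.

Lemma group_set_diagW : group_set diagW.
Proof.
apply/group_setP; split.
  apply/imset2P; exists 1 1; rewrite ?group1 //.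
  have -> : [ffun=> 1] = 1 :> base by apply/ffunP=> i; rewrite !ffunE.
  by rewrite /wr !morph1 mulg1.
move=> u v /imset2P[a p Aa _ ->] /imset2P[b q Ab _ ->]; rewrite wrM.
apply/imset2P; exists (a * b) (p * q); [exact: groupM | by rewrite inE |].
by congr (wr _ _); apply/ffunP=> i; rewrite !ffunE.
Qed.
Canonical diagW_group := Group group_set_diagW.

Canonical diagDA_group := Eval hnf in [group of diagDA].

End SimpleDiagonal.

(* Main.v *)
Require Import Defs.
From mathcomp Require Import all_boot all_order all_algebra.
From mathcomp Require Import all_fingroup all_solvable.

Set Implicit Arguments.
Unset Strict Implicit.
Unset Printing Implicit Defensive.

Import Order.TTheory.

Local Open Scope group_scope.

(** Write [H] for the point stabiliser [D_A] and [G] for [T^k.S_k], so that the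
    points are the cosets [H x]; here [T] stands for its copy [Inn T]. An orbital graph is given by some [w] in [G]
    outside [H], and [H x], [H y] are adjacent in it exactly when [y * x^-1] lies
    in [X], the union of the double cosets of [w] and [w^-1]. A bound [n] on the
    diameter therefore follows once every element of [G] is [h] times a word of
    length at most [n] in [X], with [h] in [H] ([orbdiam_rcosets_le]). The set [X]
    is closed under inversion and under multiplication by [H] on both sides, so
    the elements expressible by words of length at most [n] are stable under
    simultaneous conjugation of all coordinates by an element of [T] and under
    permutation of the coordinates.

    Multiplying [w] by a permutation, one may take [w = f] in [T^k], and [f] is not
    constant because constants lie in [H]. Say [f i <> f j], and let
    [t = f i * (f j)^-1].

    - If [i] and [j] are the only coordinates, then [(f j)^-1 f] is a word of
      length 1 which is trivial except at [i].
    - If there is a third coordinate [l], then [f] times the inverse of its image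
      under the transposition (i j) is a word [b] of length 2, equal to [t] at [i]
      and trivial outside [i] and [j]. Moving [j] to [l] and conjugating by [g]
      gives [b'], of length 2, equal to [t ^ g] at [i] and trivial outside [i]
      and [l]. The supports meet only in [i], so [[~ b, b']] is a word of length 8
      that equals [[~ t, t ^ g]] at [i] and is trivial elsewhere; some [g] makes
      this nontrivial, since otherwise the class of [t] would generate an abelian
      group.

    In both cases some nontrivial [s] in a single coordinate costs at most 8
    ([exists_single]). Every element of [T] is a product of at most [c = c_i T]
    conjugates of [s] and [s^-1], so anything in a single coordinate costs at most
    [8 c]. Modulo the diagonal one coordinate can be made trivial, and
    the others are filled one at a time, which gives [8 (k - 1) c]; this is at
    most [24 (k - 1) c ^ 2]. *)

(** * Words in a set of letters *)

Section Words.

Variables (gT : finGroupType).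
Implicit Types (S : {set gT}) (x y h : gT) (m n : nat).

Lemma prods_uptoP S n x :
  reflect (exists2 j, j <= n & x \in S ^+ j) (x \in prods_upto S n).
Proof.
apply: (iffP bigcupP) => [[j _ Sx]|[j ltj Sx]].
  by exists j; rewrite // -ltnS.
by exists (Ordinal (ltj : j < n.+1)).
Qed.

Lemma prods_upto1 S n : 1 \in prods_upto S n.
Proof. by apply/prods_uptoP; exists 0%N; rewrite ?expg0 ?set11. Qed.

Lemma prods_upto_gen S x : x \in S -> x \in prods_upto S 1%N.
Proof. by move=> Sx; apply/prods_uptoP; exists 1%N. Qed.

Lemma prods_upto_sub S m n : m <= n -> prods_upto S m \subset prods_upto S n.
Proof.
move=> lemn; apply/subsetP=> x /prods_uptoP[j lejm Sx].
by apply/prods_uptoP; exists j; rewrite // (leq_trans lejm).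
Qed.

Lemma prods_uptoM S m n x y :
  x \in prods_upto S m -> y \in prods_upto S n ->
  x * y \in prods_upto S (m + n)%N.
Proof.
move=> /prods_uptoP[i lei Sx] /prods_uptoP[j lej Sy].
by apply/prods_uptoP; exists (i + j)%N; rewrite ?leq_add // expgD mem_mulg.
Qed.

Lemma prods_upto_ind S (P : nat -> gT -> Prop) :
  P 0%N 1 -> (forall n x s, s \in S -> P n x -> P n.+1 (s * x)) ->
  (forall m n x, m <= n -> P m x -> P n x) ->
  forall n x, x \in prods_upto S n -> P n x.
Proof.
move=> P1 PM Pmono n x /prods_uptoP[j lejn Sx]; apply: Pmono lejn _.
elim: j x Sx => [|j IHj] x; first by rewrite expg0 => /set1P->.
by rewrite expgS => /mulsgP[s y Ss Sy ->]; apply: PM => //; apply: IHj.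
Qed.

Lemma prods_uptoV S n x :
  S^-1 = S -> x \in prods_upto S n -> x^-1 \in prods_upto S n.
Proof.
move=> SV; apply: (prods_upto_ind (P := fun n x => x^-1 \in prods_upto S n)).
- by rewrite invg1 prods_upto1.
- move=> {}n {}x s Ss xn; rewrite invMg -addn1 prods_uptoM //.
  by apply: prods_upto_gen; rewrite -mem_invg SV.
- by move=> m {}n {}x /prods_upto_sub/subsetP; apply.
Qed.

End Words.

(** Substitution in words: applying a map that is multiplicative on a group
    containing the letters replaces each letter by a word of length at most [a],
    so lengths are multiplied by at most [a]. *)
Lemma prods_upto_subst (gT rT : finGroupType) (G : {group gT})
    (f : gT -> rT) (S : {set gT}) (R : {set rT}) a n x :
    S \subset G -> f 1 = 1 -> {in G &, {morph f : u v / u * v}} ->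
    {in S, forall s, f s \in prods_upto R a} ->
  x \in prods_upto S n -> f x \in prods_upto R (a * n)%N.
Proof.
move=> /subsetP SG f1 fM fS xn.
suff []: x \in G /\ f x \in prods_upto R (a * n)%N by [].
move: n x xn; apply: prods_upto_ind => [|n x s Ss [Gx fx]|m n x lemn [Gx fx]].
- by rewrite f1 group1 prods_upto1.
- have Gs := SG s Ss; rewrite groupM //; split=> //.
  by rewrite fM // mulnS prods_uptoM ?fS.
- split=> //; apply: subsetP fx.
  by rewrite prods_upto_sub // leq_mul2l lemn orbT.
Qed.

(** * Orbital graphs on cosets and words in double cosets *)

Section OrbitalDistance.

Variables (gT : finGroupType) (H G : {group gT}).
Hypothesis sHG : H \subset G.

(** The quotients [v * u^-1] along edges [(H u, H v)]: the inverse of [w] is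
    included because orbital graphs are undirected. *)
Definition double_cosets (w : gT) : {set gT} := H * [set w; w^-1] * H.

Lemma double_cosets_id w : w \in double_cosets w.
Proof.
by rewrite -{1}[w]mul1g -{1}[1 * w]mulg1 !mem_mulg ?group1 // !inE eqxx.
Qed.

Lemma double_cosetsV w : (double_cosets w)^-1 = double_cosets w.
Proof.
rewrite /double_cosets !invMg invGid mulgA; congr (_ * _ * _).
by apply/setP=> x; rewrite !inE -(inj_eq invg_inj) invgK (inj_eq invg_inj) orbC.
Qed.

Lemma double_cosetsMl w h x :
  h \in H -> x \in double_cosets w -> h * x \in double_cosets w.
Proof.
move=> Hh /mulsgP[_ b /mulsgP[a v Ha v_in ->] Hb ->].
by rewrite 2!mulgA !mem_mulg ?groupM.
Qed.

Lemma double_cosetsMr w h x :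
  h \in H -> x \in double_cosets w -> x * h \in double_cosets w.
Proof.
move=> Hh; rewrite /double_cosets => /mulsgP[u v Hu v_in ->].
by rewrite -mulgA mem_mulg ?groupM.
Qed.

(** This allows the representative of an orbital to be normalised. *)
Lemma double_cosetsE w a b :
  a \in H -> b \in H -> double_cosets (a * w * b) = double_cosets w.
Proof.
have sub v g h : g \in H -> h \in H ->
    double_cosets (g * v * h) \subset double_cosets v.
  move=> Hg Hh; apply/subsetP=> _ /mulsgP[_ d /mulsgP[c x Hc x_in ->] Hd ->].
  have gvh : g * v * h \in double_cosets v.
    by rewrite double_cosetsMr ?double_cosetsMl ?double_cosets_id.
  rewrite double_cosetsMr ?double_cosetsMl //; move: x_in; rewrite !inE.
  by case/orP=> /eqP-> //; rewrite -mem_invg double_cosetsV.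
move=> Ha Hb; apply/eqP; rewrite eqEsubset sub //=.
have defw : w = a^-1 * (a * w * b) * b^-1.
  by rewrite !mulgA mulVg mul1g mulgK.
by rewrite {1}defw sub ?groupV.
Qed.

(** Conjugating a word by [H] conjugates its letters, and conjugating a letter
    multiplies it by [H] on both sides. *)
Lemma prods_upto_conj w n h x : h \in H ->
  x \in prods_upto (double_cosets w) n ->
  x ^ h \in prods_upto (double_cosets w) n.
Proof.
move=> Hh; rewrite -[n in X in _ -> X]mul1n.
apply: (prods_upto_subst (G := [set: gT]%G) (f := conjg^~ h)) => //.
- exact: subsetT.
- exact: conj1g.
- by move=> u v _ _; rewrite conjMg.
move=> s Ss; rewrite prods_upto_gen // /conjg.
by rewrite double_cosetsMl ?double_cosetsMr ?groupV.
Qed.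

(** If [b * a^-1 = h * (y * x^-1) * h'] with [h] and [h'] in [H], then
    [x^-1 * h' * a] moves [(H x, H y)] to [(H a, H b)]. *)
Lemma orbital_edge x y u v :
    x \in G -> y \in G -> u \in G -> v \in G ->
    v * u^-1 \in double_cosets (y * x^-1) ->
  orbital_graph (orbit (pair_action 'Rs) G (H :* x, H :* y)) (H :* u) (H :* v).
Proof.
move=> Gx Gy.
have rcosHM h z : h \in H -> H :* (h * z) = H :* z.
  by move=> Hh; rewrite rcosetM rcoset_id.
have edge a b : a \in G -> b * a^-1 \in H :* (y * x^-1) * H ->
    (H :* a, H :* b) \in orbit (pair_action 'Rs) G (H :* x, H :* y).
  move=> Ga /mulsgP[_ h' /rcosetP[h Hh ->] Hh' def_b].
  apply/orbitP; exists (x^-1 * h' * a).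
    by rewrite !groupM ?groupV // (subsetP sHG).
  rewrite /= /pair_act /=; congr (_, _); rewrite !rcosetE -rcosetM.
    by rewrite !mulgA mulgV mul1g rcosHM.
  have ->: b = h * (y * (x^-1 * h' * a)).
    by rewrite -[LHS](mulgKV a) def_b !mulgA.
  by rewrite (rcosHM h).
move=> Gu Gv /mulsgP[_ h' /mulsgP[h z Hh z_in ->] Hh' def_v].
rewrite /orbital_graph /=; move: z_in; rewrite !inE => /orP[]/eqP zE.
  rewrite edge // def_v zE mem_mulg //.
  by apply/rcosetP; exists h.
rewrite [X in _ || X]edge ?orbT //.
have -> : u * v^-1 = h'^-1 * (y * x^-1) * h^-1.
  apply: invg_inj; rewrite (invMg u) invgK def_v zE.
  by rewrite (invMg _ h^-1) invgK (invMg h'^-1) invgK mulgA.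
rewrite mem_mulg ?groupV //.
by apply/rcosetP; exists h'^-1; rewrite ?groupV.
Qed.

Lemma orbital_walk x y u v n :
    x \in G -> y \in G -> u \in G -> v \in G ->
    v * u^-1 \in double_cosets (y * x^-1) ^+ n ->
  exists p,
    [/\ path (orbital_graph (orbit (pair_action 'Rs) G (H :* x, H :* y)))
             (H :* u) p,
        last (H :* u) p = H :* v & size p = n].
Proof.
move=> Gx Gy Gu; elim: n v => [|n IHn] v Gv.
  rewrite expg0 => /set1P/eqP; rewrite -eq_mulgV1 => /eqP->.
  by exists [::].
rewrite expgS => /mulsgP[d z Dd zn def_v].
have Gd : d \in G.
  move: Dd => /mulsgP[_ h' /mulsgP[h e Hh e_in ->] Hh' ->].
  rewrite !groupM ?(subsetP sHG _ Hh) ?(subsetP sHG _ Hh') //.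
  by move: e_in; rewrite !inE => /orP[]/eqP->; rewrite ?groupV groupM ?groupV.
have defzu : z * u = d^-1 * v.
  by apply: (mulgI d); rewrite mulKVg mulgA -def_v mulgKV.
have Gzu : z * u \in G by rewrite defzu groupM ?groupV.
have [|p [pp lp sp]] := IHn _ Gzu; first by rewrite mulgK.
exists (rcons p (H :* v)); rewrite last_rcons size_rcons sp; split=> //.
rewrite rcons_path pp lp /=; apply: orbital_edge => //.
by rewrite defzu invMg invgK mulKVg.
Qed.

(** The factor [H] on the left is harmless because [H u] and [H (h * u)] are the
    same vertex. Only the diagonal orbital has its representative [w] in [H]. *)
Lemma orbdiam_rcosets_le n :
    {in G :\: H, forall w, G \subset H * prods_upto (double_cosets w) n} ->
  (orbdiam 'Rs G (rcosets H G) <= (n%:Z)%:E)%E.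
Proof.
move=> covG; have n_ge0 : (0 <= (n%:Z)%:E :> \bar int)%E by rewrite lee_fin.
apply: bigmax_le => // Gamma /andP[/imsetP[[X Y]]].
rewrite inE /= => /andP[/rcosetsP[x Gx ->] /rcosetsP[y Gy ->]] -> {X Y}.
move=> nondiag; apply: bigmax_le => // _ /rcosetsP[u Gu ->].
apply: bigmax_le => // _ /rcosetsP[v Gv ->].
have Gw : y * x^-1 \in G :\: H.
  rewrite in_setD (groupM Gy) ?groupV // andbT.
  apply: contra nondiag => Hw.
  have -> : H :* y = H :* x by rewrite -(mulgKV x y) rcosetM (rcoset_id Hw).
  apply/eqP/setP=> p.
  apply/orbitP/imsetP=> [[g Gg <-]|[_ /rcosetsP[z Gz ->] ->]].
    exists (H :* (x * g)); last by rewrite /= /pair_act /= !rcosetE -rcosetM.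
    by apply/rcosetsP; exists (x * g); rewrite ?groupM.
  exists (x^-1 * z); first by rewrite groupM ?groupV.
  by rewrite /= /pair_act /= !rcosetE -rcosetM mulKVg.
have /mulsgP[h d Hh /prods_uptoP[j lejn dj] vu] :
    v * u^-1 \in H * prods_upto (double_cosets (y * x^-1)) n.
  by rewrite (subsetP (covG _ Gw)) ?groupM ?groupV.
have -> : H :* v = H :* (d * u).
  by rewrite -[v](mulgKV u) vu -mulgA [in LHS]rcosetM rcoset_id.
have Gd : d * u \in G.
  have -> : d * u = h^-1 * v by rewrite -[v](mulgKV u) vu -mulgA mulKg.
  by rewrite groupM ?groupV ?(subsetP sHG h).
have [|p [pp lp sp]] := orbital_walk Gx Gy Gu Gd (n := j).
  by rewrite mulgK.
by apply/gdist_leP; exists p; rewrite ?sp.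
Qed.

End OrbitalDistance.

(** * Conjugacy classes of a finite simple group *)

Section SimpleGroups.

Variables (gT : finGroupType) (T : {group gT}).
Hypotheses (simpleT : simple T) (nonabT : ~~ abelian T).

Lemma simple_gen_class t : t \in T^# -> <<t ^: T>> = T.
Proof.
case/setD1P=> nt_t Tt; have [_ minT] := simpleP _ simpleT.
have nsT : <<t ^: T>> <| T.
  rewrite /normal gen_subG class_subG //=.
  exact: subset_trans (class_norm t T) (norm_gen _).
have [/= triv|//] := minT _ nsT.
have : t \in <<t ^: T>> by rewrite mem_gen ?class_refl.
by rewrite triv inE (negPf nt_t).
Qed.

(** Otherwise the conjugates of [t] would commute pairwise, and the group they
    generate, which is all of [T], would be abelian. *)
Lemma simple_commg_conj t :
  t \in T^# -> exists2 g, g \in T & [~ t, t ^ g] != 1.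
Proof.
move=> Tt; apply/exists_inP; apply: contraR nonabT => /exists_inPn comm1.
rewrite -(simple_gen_class Tt) abelian_gen; apply/centsP.
move=> _ /imsetP[g Tg ->] _ /imsetP[h Th ->].
have -> : t ^ h = (t ^ (h * g^-1)) ^ g by rewrite -conjgM mulgKV.
have /comm1 : h * g^-1 \in T by rewrite groupM ?groupV.
rewrite negbK => /commgP cth.
by rewrite /commute -!conjMg cth.
Qed.

Lemma simple_prods_upto_c_i t : t \in T^# ->
  T \subset prods_upto (t ^: T :|: t^-1 ^: T) (c_i T).
Proof.
move=> Tt; have [_ Tgt] := setD1P Tt.
have genT : <<t ^: T :|: t^-1 ^: T>> = T.
  apply/eqP; rewrite eqEsubset gen_subG subUset !class_subG ?groupV //=.
  by rewrite -{1}(simple_gen_class Tt) genS // subsetUl.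
have [Tsub _] := widthP genT.
by apply: subset_trans Tsub _; apply: prods_upto_sub; apply: leq_bigmax_cond.
Qed.

Lemma isog_Inn : T \isog Inn T.
Proof.
have cent1 : 'Z(T) = 1.
  have [_ minT] := simpleP _ simpleT.
  have [//|/= ZT] := minT _ (center_normal T).
  by case/negP: nonabT; rewrite -ZT center_abelian.
have := first_isog_loc (conj_aut T) (normG T).
by rewrite ker_conj_aut [_ :&: _]cent1; apply: isog_trans (quotient1_isog T).
Qed.

(** The coordinates of the diagonal group are inner automorphisms, whereas the
    width is measured in [T]: words are carried over by [conj_aut T]. *)
Lemma Inn_prods_upto_c_i s : s \in (Inn T)^# ->
  Inn T \subset prods_upto (s ^: Inn T :|: s^-1 ^: Inn T) (c_i T).
Proof.
have nT g : g \in T -> g \in 'N(T) by apply/subsetP/normG.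
case/setD1P=> nt_s /morphimP[t _ Tt def_s].
have T't : t \in T^#.
  rewrite !inE Tt andbT; apply: contraNneq nt_s => t1.
  by rewrite def_s t1 morph1.
apply/subsetP=> _ /morphimP[x _ Tx ->].
have := subsetP (simple_prods_upto_c_i T't) x Tx.
rewrite -[c_i T in X in _ -> X]mul1n.
apply: (@prods_upto_subst _ _ T (conj_aut T)).
- by rewrite subUset !class_subG ?groupV.
- exact: morph1.
- by move=> u v Tu Tv; rewrite /= morphM ?nT.
move=> _ /setUP[]/imsetP[g Tg ->]; apply: prods_upto_gen; rewrite inE.
  by rewrite morphJ ?nT //= -def_s memJ_class // mem_morphim ?nT.
rewrite morphJ ?morphV ?nT ?groupV //= -def_s.
by rewrite memJ_class ?orbT // mem_morphim ?nT.
Qed.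

End SimpleGroups.

(** * Words in a wreath product over a simple group *)

Section WreathElements.

Variables (K : finGroupType) (k : nat).

Local Notation base := {dffun forall _ : 'I_k, K}.
Local Notation single i a := (@dfung1 'I_k (fun=> K) i a : base).

Implicit Types (f g : base) (pi : 'S_k) (i j : 'I_k).

Lemma wr_split f pi : wr f pi = wr f 1 * wr 1 pi.
Proof. by rewrite /wr !morph1 mulg1 mul1g. Qed.

Lemma wrM1 f g : wr f 1 * wr g 1 = wr (f * g) 1.
Proof.
rewrite wrM mulg1; congr (wr _ _).
by apply/ffunP=> i; rewrite !ffunE; congr (_ * g _); apply: perm1.
Qed.

Lemma wrV1 f : (wr f 1)^-1 = wr f^-1 1.
Proof. by apply/eqP; rewrite eq_invg_mul wrM1 mulgV /wr !morph1 mulg1. Qed.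

Lemma wrR1 f g : [~ wr f 1, wr g 1] = wr [~ f, g] 1.
Proof. by rewrite !commgEl /conjg !wrV1 !wrM1. Qed.

Lemma wrJ_perm f pi : wr f 1 ^ wr 1 pi = wr [ffun i => f (pi^-1 i)] 1.
Proof.
apply: (mulgI (wr 1 pi)); rewrite -conjgC !wrM mulg1 mul1g.
congr (wr _ _); apply/ffunP=> i.
rewrite !ffunE mul1g permK mulg1; congr (f _); apply: esym; apply: perm1.
Qed.

Lemma wrJ_diag f a : wr f 1 ^ wr [ffun=> a] 1 = wr [ffun i => f i ^ a] 1.
Proof.
rewrite /conjg wrV1 !wrM1; congr (wr _ _).
by apply/ffunP=> i; rewrite !ffunE.
Qed.

Lemma singleE i a j : single i a j = if j == i then a else 1.
Proof.
have [->|ne_ji] := eqVneq j i; first by rewrite dfung1_id.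
by rewrite dfung1_dflt // eq_sym.
Qed.

End WreathElements.

Section WreathCovering.

Variables (K : finGroupType) (k : nat) (P : {group K}).
Variables (H : {group wreath K k}) (w : wreath K k).
Hypotheses (simpleP : simple P) (nonabP : ~~ abelian P).
Hypothesis diagH : forall a, a \in P -> wr [ffun=> a] 1 \in H.
Hypothesis permH : forall pi : 'S_k, wr 1 pi \in H.

Local Notation base := {dffun forall _ : 'I_k, K}.
Local Notation single i a := (@dfung1 'I_k (fun=> K) i a : base).
Local Notation B n := (prods_upto (double_cosets H w) n).

Implicit Types (f : base) (pi : 'S_k) (i j : 'I_k).

Lemma single_perm i j a n :
  wr (single i a) 1 \in B n -> wr (single j a) 1 \in B n.
Proof.
have -> : single j a = [ffun l => single i a ((tperm i j)^-1 l)].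
  apply/ffunP=> l; rewrite [RHS]ffunE tpermV !singleE.
  by rewrite -(inj_eq (@perm_inj _ (tperm i j))) tpermR.
by rewrite -wrJ_perm; apply: prods_upto_conj.
Qed.

(** The commutator of two elements whose supports meet only in [i] is supported
    at [i]. Two such elements are obtained from [f] by dividing it by its image
    under a transposition, which needs a third coordinate [l]; with only two
    coordinates, dividing [f] by a constant is enough. *)
Lemma exists_single f i j :
    (forall l, f l \in P) -> f i != f j -> wr f 1 \in double_cosets H w ->
  exists2 s, s \in P^# & wr (single i s) 1 \in B 8.
Proof.
move=> Pf ne_fij wf; have DV := double_cosetsV H w.
have [/existsP[l /andP[ne_li ne_lj]]|/existsPn ijT] :=
  boolP [exists l, (l != i) && (l != j)]; last first.
  exists ((f j)^-1 * f i).
    by rewrite !inE -eq_invg_mul invgK eq_sym ne_fij groupM ?groupV.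
  apply: subsetP (prods_upto_sub _ (isT : 1 <= 8)) _ (prods_upto_gen _).
  have -> : single i ((f j)^-1 * f i) = [ffun=> (f j)^-1] * f.
    apply/ffunP=> l; rewrite singleE !ffunE; case: eqVneq => [->//|ne_li].
    by have := ijT l; rewrite ne_li /= negbK => /eqP->; rewrite mulVg.
  by rewrite -wrM1 double_cosetsMl ?diagH ?groupV.
pose t := f i * (f j)^-1.
have Pt : t \in P by rewrite groupM ?groupV.
have nt_t : t != 1 by rewrite -eq_mulgV1.
have [|g Pg nt_c] := simple_commg_conj simpleP nonabP (t := t).
  by rewrite !inE nt_t.
have wf1 := prods_upto_gen wf.
pose b := f * [ffun l => f (tperm i j l)]^-1.
have wb : wr b 1 \in B 2.
  rewrite -wrM1 -wrV1 (prods_uptoM (m := 1) (n := 1)) ?prods_uptoV //.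
  by rewrite -[tperm i j]tpermV -wrJ_perm prods_upto_conj.
pose b' : base := [ffun m => [ffun m => b ((tperm j l)^-1 m)] m ^ g].
have wb' : wr b' 1 \in B 2.
  by rewrite -wrJ_diag -wrJ_perm !prods_upto_conj ?diagH.
exists [~ t, t ^ g]; first by rewrite !inE nt_c groupR ?groupJ.
have -> : single i [~ t, t ^ g] = [~ b, b'].
  have bE m : b m = f m * (f (tperm i j m))^-1 by rewrite !ffunE.
  apply/ffunP=> m; rewrite singleE.
  have -> : [~ b, b'] m = [~ b m, b' m] by rewrite !commgEl /conjg !ffunE.
  rewrite [b' m]ffunE [[ffun _ => _] m]ffunE tpermV.
  have [->|ne_mi] := eqVneq m i.
    have ne_ji : j != i by apply: contraNneq ne_fij => ->.
    by rewrite tpermD // !bE tpermL.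
  have [->|ne_mj] := eqVneq m j.
    by rewrite tpermL [b l]bE tpermD 1?eq_sym // mulgV conj1g commg1.
  by rewrite [b m]bE tpermD 1?eq_sym // mulgV comm1g.
(* The factors of [b^-1 * (b'^-1 * (b * b'))] have length 2 each. *)
rewrite -wrR1 commgEl /conjg.
rewrite (prods_uptoM (m := 2) (n := 6)) ?prods_uptoV //.
rewrite (prods_uptoM (m := 2) (n := 4)) ?prods_uptoV //.
by rewrite (prods_uptoM (m := 2) (n := 2)) ?prods_uptoV.
Qed.

(** Conjugating [s] in coordinate [i] by elements of [P] costs nothing, so each
    letter of a word in the conjugates of [s] and [s^-1] costs at most [n]. *)
Lemma all_single s i c n :
    s \in P -> wr (single i s) 1 \in B n ->
    P \subset prods_upto (s ^: P :|: s^-1 ^: P) c ->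
  forall a j, a \in P -> wr (single j a) 1 \in B (n * c).
Proof.
move=> Ps ws /subsetP covP a j /covP; move: c a {covP} => c a.
apply: (prods_upto_subst (G := P) (f := fun a => wr (single j a) 1)).
- by rewrite subUset !class_subG ?groupV.
- rewrite /= /wr.
  have -> : single j 1 = 1 by apply/ffunP=> l; rewrite singleE ffunE if_same.
  by rewrite !morph1 mulg1.
- by move=> u v _ _; rewrite /= wrM1 -dfung1_morphM.
have wsj := single_perm j ws.
have conjB (r g : K) :
    g \in P -> wr (single j r) 1 \in B n -> wr (single j (r ^ g)) 1 \in B n.
  move=> Pg wr_r; have -> : single j (r ^ g) = [ffun l => single j r l ^ g].
    apply/ffunP=> l; rewrite [RHS]ffunE !singleE.
    by case: ifP => // _; rewrite conj1g.
  by rewrite -wrJ_diag prods_upto_conj ?diagH.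
move=> _ /setUP[]/imsetP[g Pg ->]; apply: conjB => //.
have -> : single j s^-1 = (single j s)^-1.
  apply/ffunP=> l; rewrite [RHS]invg_ffun !singleE.
  by case: ifP; rewrite ?invg1.
by rewrite -wrV1 prods_uptoV // double_cosetsV.
Qed.

(** Modulo [H] on either side, [wr f pi] becomes an element of the base that is
    trivial at a chosen coordinate [i0]; its other [k.-1] coordinates are then
    produced one at a time. *)
Lemma wr_cover n f pi :
    0 < k -> (forall a j, a \in P -> wr (single j a) 1 \in B n) ->
    (forall l, f l \in P) ->
  wr f pi \in H * B (n * k.-1).
Proof.
move=> k_gt0 wP Pf; pose i0 := Ordinal k_gt0.
pose restr (r : seq 'I_k) : base :=
  [ffun l => if l \in r then (f i0)^-1 * f l else 1].
have wr_restr r : wr (restr r) 1 \in B (n * size r).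
  elim: r => [|j r IHr].
    have -> : restr [::] = 1 by apply/ffunP=> l; rewrite !ffunE.
    by rewrite /wr !morph1 mulg1 prods_upto1.
  have [jr|j'r] := boolP (j \in r).
    have -> : restr (j :: r) = restr r.
      apply/ffunP=> l; rewrite !ffunE inE.
      by case: eqVneq => //= ->; rewrite jr.
    by apply: subsetP IHr; rewrite prods_upto_sub // leq_mul2l leqnSn orbT.
  have -> : restr (j :: r) = single j ((f i0)^-1 * f j) * restr r.
    apply/ffunP=> l; rewrite [RHS]ffunE singleE !ffunE inE.
    by case: eqVneq => [->|_]; rewrite /= ?(negPf j'r) ?mulg1 ?mul1g.
  by rewrite -wrM1 mulnS prods_uptoM // wP ?groupM ?groupV.
pose r := enum (predC1 i0).
have sz_r : size r = k.-1 by rewrite -cardE cardC1 card_ord.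
have def_f : f = [ffun=> f i0] * restr r.
  apply/ffunP=> l; rewrite !ffunE mem_enum !inE.
  by case: eqVneq => [->|_] /=; rewrite ?mulg1 ?mulKVg.
(* The permutation belongs on the left, with the constant. *)
rewrite wr_split {1}def_f -wrM1 -mulgA (conjgC (wr (restr r) 1)) mulgA.
rewrite -sz_r mem_mulg //; first exact: groupM (diagH (Pf i0)) (permH pi).
exact: prods_upto_conj (permH pi) (wr_restr r).
Qed.

End WreathCovering.

(** * The orbital diameter of the diagonal group *)

Theorem theorem6p1 (gT : finGroupType) (T : {group gT}) (k : nat)
    (simpleT : simple T) (nonabT : ~~ abelian T) (k_ge2 : (2 <= k)%N)
    (primG : [primitive diagG T k, on diagOmega T k | 'Rs]) :
  (orbdiam 'Rs (diagG T k) (diagOmega T k)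
     <= ((24 * (k - 1) * c_i T ^ 2)%N%:Z)%:E)%E.
Proof.
have isoT := isog_Inn simpleT nonabT.
have simpleP : simple (Inn T) by rewrite -(isog_simple isoT).
have nonabP : ~~ abelian (Inn T) by rewrite -(isog_abelian isoT).
have permDA pi : wr 1 pi \in diagDA_group T k.
  rewrite inE; apply/andP; split.
    have -> : 1 = [ffun=> 1] :> {dffun forall _ : 'I_k, {perm gT}}.
      by apply/ffunP=> i; rewrite !ffunE.
    by apply: imset2_f; [exact: group1 | exact: in_setT].
  by apply/diagGP; exists 1; [move=> i; rewrite ffunE group1 | exists pi].
have constDA a : a \in Inn T -> wr [ffun=> a] 1 \in diagDA_group T k.
  move=> Pa; rewrite inE; apply/andP; split.
    by apply: imset2_f; [exact: subsetP (Inn_sub_Aut T) a Pa | exact: in_setT].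
  by apply/diagGP; exists [ffun=> a]; [move=> i; rewrite ffunE | exists 1].
apply: (@orbdiam_rcosets_le _ (diagDA_group T k) (diagG_group T k)).
  exact: subsetIr.
move=> w /setDP[/diagGP[f Pf [pi ->]] notH]; rewrite wr_split in notH *.
rewrite -[wr f 1]mul1g double_cosetsE //.
have [i [j ne_fij]] : exists i j, f i != f j.
  pose i0 := Ordinal (ltnW k_ge2); exists i0.
  apply/existsP; apply: contraR notH => /existsPn const_f.
  rewrite groupM //.
  have -> : f = [ffun=> f i0].
    by apply/ffunP=> l; rewrite ffunE; have := const_f l; rewrite negbK => /eqP.
  exact: constDA.
have [s P's ws] :=
  exists_single simpleP nonabP constDA permDA Pf ne_fij (double_cosets_id _ _).
have [_ Ps] := setD1P P's; have covP := Inn_prods_upto_c_i simpleT P's.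
have wP := all_single constDA permDA Ps ws covP.
apply/subsetP=> _ /diagGP[g Pg [rho ->]].
have := wr_cover constDA permDA rho (ltnW k_ge2) wP Pg.
apply: subsetP; apply: mulgS; apply: prods_upto_sub.
(* 8 * c * (k - 1) against 24 * (k - 1) * c ^ 2 *)
rewrite -subn1 mulnAC leq_mul //.
  by rewrite leq_mul2r orbT.
by rewrite expnS expn1; case: (c_i T) => // c; rewrite leq_pmulr.
Qed.
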